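(* Let $P \in \mathbb{C}[X]$ be a polynomial of degree $d \ge 1$ with exactly $r$ distinct complex roots. Let $G=(V,E)$ be a finite simple undirected graph (no loops, no multiple edges) whose vertex set $V$ is a subset of the set of distinct complex roots of $P$. Then $$ \prod_{\{v_i, v_j\} \in E} |v_i - v_j| \ \ge \ |\mathrm{sDisc}_{d-r}(P)|^{1/2} \, \mathrm{M}(P)^{-(r-1)} \, \Big(\frac{r}{\sqrt{3}}\Big)^{-\#E} \,r^{-r/2} \, \Big(\frac13\Big)^{\min \{d,\, 2d-2r\}/6}, $$ where the product runs over the edges of $G$ (each edge counted once) and $\#E$ is the number of edges.
   Context: Write $P = a_d \prod_{j=1}^r (X - v_j)^{m_j}$ with $a_d \ne 0$, $v_1,\dots,v_r$ pairwise distinct, $m_j \in \mathbb{N}$, $\sum_j m_j = d$; let $x_1,\dots,x_d$ be the roots of $P$ listed with multiplicity. The Mahler measure is $\mathrm{M}(P) = |a_d| \prod_{i=1}^d \max\{1,|x_i|\}$. For $0 \le k < d$, the $k$-th subdiscriminant is $\mathrm{sDisc}_k(P) = a_d^{2(d-k)-2} \sum_{I \subset \{1,\dots,d\},\ |I| = d-k} \ \prod_{i,j \in I,\ i<j} (x_i - x_j)^2$. In particular $|\mathrm{sDisc}_{d-r}(P)|^{1/2} = |a_d|^{r-1} \big(\prod_{j=1}^r m_j\big)^{1/2} \prod_{1\le i<j\le r}|v_i - v_j|$, and when $P$ is square-free ($r=d$) $\mathrm{sDisc}_0(P)$ is the discriminant of $P$ up to sign. *)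

(* Defs.v *)
From HB Require Import structures.
From mathcomp Require Import all_boot all_order all_algebra.
Set Implicit Arguments. Unset Strict Implicit. Unset Printing Implicit Defensive.
Import Order.TTheory GRing.Theory Num.Theory.
Local Open Scope ring_scope.

(* Mahler measure of a polynomial with leading coefficient [a] and roots
   (listed with multiplicity) [xs]. *)
Definition mahler (C : numClosedFieldType) (a : C) (xs : seq C) : C :=
  `|a| * \prod_(x <- xs) Num.max 1 `|x|.

(* k-th subdiscriminant of the polynomial with leading coefficient [a] and
   roots (with multiplicity) [xs], d = size xs :
   a^(2(d-k)-2) * sum_{I subset {1..d}, |I| = d-k} prod_{i<j in I} (x_i - x_j)^2 *)
Definition sDisc (C : numClosedFieldType) (a : C) (xs : seq C) (k : nat) : C :=
  let d := size xs in
  a ^+ (2 * (d - k) - 2) *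
  \sum_(I : {set 'I_d} | #|I| == (d - k)%N)
     \prod_(i in I) \prod_(j in I | (i < j)%N) (xs`_i - xs`_j) ^+ 2.

(* Main.v *)
(** Order the distinct roots [v_0, ..., v_(r-1)] by increasing modulus.  In the
    Vandermonde matrix, replace the powers of [v_j] by the divided differences of
    the monomials at [v_j] and its neighbours preceding it: this is a triangular
    operation dividing the determinant by the product of the edge lengths.  If
    [v_j] has [s] earlier neighbours, the new entries are bounded by
    ['C(k, s) * max(1, |v_j|)^(r-1)], so that Hadamard's inequality and
    [sum_(k < r) 'C(k, s)^2 <= r (r^2/3)^s] bound the product of the root
    differences by that of the edge lengths.  On the other side, a nonzero summand
    of the subdiscriminant chooses one index for each distinct root, whence the
    factor [prod_j m_j], and [m^3 <= 3^m], [m^3 <= 9^(m-1)] bound that product. *)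

Require Import Defs.
From HB Require Import structures.
From mathcomp Require Import all_boot all_order all_algebra.
From mathcomp Require Import zify ring.
Set Implicit Arguments. Unset Strict Implicit. Unset Printing Implicit Defensive.
Import Order.TTheory GRing.Theory Num.Theory.
Local Open Scope ring_scope.

(** * Hadamard's determinant inequality *)

Section Hadamard.
Local Open Scope sesquilinear_scope.

Lemma mulmx_tr_conj_diag (C : numClosedFieldType) (m n : nat) (A : 'M[C]_(m, n)) i :
  (A *m A^t*) i i = \sum_j `|A i j| ^+ 2.
Proof. by rewrite !mxE; apply: eq_bigr => j _; rewrite !mxE normCK. Qed.

Lemma norm_det_unitary (C : numClosedFieldType) (n : nat) (Q : 'M[C]_n) :
  Q \is unitarymx -> `|\det Q| = 1.
Proof.
move=> /unitarymxP/(congr1 determinant); rewrite det_mulmx det1 det_map_mx det_tr.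
by rewrite -normCK => /eqP; rewrite sqrp_eq1 // => /eqP.
Qed.

(** Gram-Schmidt puts row [i] of [A] in the span of the orthonormal rows of index at most [i], and
    these are orthogonal to every later row. *)
Lemma is_trig_mx_schmidt (C : numClosedFieldType) (n : nat) (A : 'M[C]_n) :
  is_trig_mx (A *m (schmidt A)^t*).
Proof.
set Q := schmidt A; have Qu : Q \is unitarymx by exact: schmidt_unitarymx.
apply/is_trig_mxP => i j ltij.
have /sub_sumsmxP[u rowiA] := row_schmidt_sub A i.
have -> : (A *m Q^t*) i j = (row i A *m Q^t*) 0 j.
  by rewrite !mxE; apply: eq_bigr => k _; rewrite !mxE.
rewrite rowiA mulmx_suml summxE big1 // => k leki.
have /submxP[w ->] : (u k *m <<row k Q>> <= row k Q)%MS.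
  by rewrite (submx_trans (submxMl _ _)) // genmxE.
rewrite -mulmxA -row_mul (unitarymxP Qu) !mxE big1 // => l _.
rewrite !mxE; case: eqP => [kj|]; last by rewrite mulr0.
by move: leki; rewrite kj leqNgt ltij.
Qed.

(** In [A = L *m Q] the unitary factor changes neither the modulus of the determinant nor the norms
    of the rows, and for triangular [L] each squared diagonal modulus is one term of a squared row
    norm. *)
Lemma hadamard (C : numClosedFieldType) (n : nat) (A : 'M[C]_n) :
  `|\det A| ^+ 2 <= \prod_i \sum_j `|A i j| ^+ 2.
Proof.
set Q := schmidt A; have Qu : Q \is unitarymx by exact: schmidt_unitarymx.
set L := A *m Q^t*.
have AE : A = L *m Q by rewrite /L mulmxKtV.
rewrite {1}AE det_mulmx normrM (norm_det_unitary Qu) mulr1.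
rewrite (det_trig (is_trig_mx_schmidt A)) normr_prod -prodrXl.
apply: ler_prod => i _; rewrite exprn_ge0 //=.
have -> : \sum_j `|A i j| ^+ 2 = \sum_j `|L i j| ^+ 2.
  rewrite -!mulmx_tr_conj_diag; congr (fun_of_matrix _ i i).
  rewrite {1 2}AE trmx_mul map_mxM mulmxA -[L *m Q *m _]mulmxA.
  by rewrite (unitarymxP Qu) mulmx1.
by rewrite (bigD1 i) //= lerDl sumr_ge0 // => j _; rewrite exprn_ge0.
Qed.
End Hadamard.

(** * Divided differences of monomials *)

Section DividedPower.
Variables (C : numClosedFieldType) (r : nat) (v : 'I_r -> C).
Implicit Types (T : {set 'I_r}) (k : nat).

(* The divided difference of the monomial X^k at the nodes v_i, i in T. *)
Definition divpow k T : C :=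
  \sum_(i in T) v i ^+ k / \prod_(l in T :\ i) (v i - v l).

Hypothesis v_inj : injective v.

(** Write [v i = v a + (v i - v a)]: the second part cancels the factor of [a] in the denominator,
    and it vanishes at [i = a]. *)
Lemma divpowS k T a : a \in T ->
  divpow k.+1 T = v a * divpow k T + divpow k (T :\ a).
Proof.
move=> aT; apply/eqP; rewrite -subr_eq0 opprD addrA subr_eq0; apply/eqP.
rewrite /divpow mulr_sumr -sumrB (bigD1 a) //= exprS mulrA subrr add0r.
rewrite [RHS](eq_bigl (fun i => (i \in T) && (i != a))); last first.
  by move=> i; rewrite !inE andbC.
apply: eq_bigr => i /andP[iT ia].
rewrite (big_setD1 a) /=; last by rewrite !inE eq_sym ia.
have -> : T :\ i :\ a = T :\ a :\ i by rewrite !setDDl setUC.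
rewrite exprS mulrA -mulrBl -mulrBl.
have := ia; rewrite -(inj_eq v_inj) -subr_eq0 => via.
by rewrite invfM mulrCA !mulrA mulVf // mul1r.
Qed.

Lemma divpow0 T : divpow 0 T = (#|T| == 1)%:R.
Proof.
have [n leT] := ubnP #|T|; elim: n T leT => // n IHn T leT.
have [T0|[a aT]] := set_0Vmem T.
  by rewrite T0 /divpow big_set0 cards0.
have [Ta0|[b bTa]] := set_0Vmem (T :\ a).
  rewrite (cardsD1 a) aT Ta0 cards0 /divpow (big_setD1 a) //= Ta0 !big_set0.
  by rewrite divr1 addr0.
have := bTa; rewrite !inE => /andP[ba bT].
have aTb : a \in T :\ b by rewrite !inE eq_sym ba.
have cTa : #|T :\ a| = #|T :\ b|.
  by have := cardsD1 a T; rewrite (cardsD1 b T) aT bT !add1n => -[->].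
have ltTa : (#|T :\ a| < n)%N by move: leT; rewrite (cardsD1 a) aT.
(* Expanding [divpow 1 T] at [a] and at [b] gives remainders that agree by induction, so
   [(v a - v b) * divpow 0 T = 0]. *)
have := divpowS 0 aT; rewrite (divpowS 0 bT) (IHn (T :\ a)) // (IHn (T :\ b)) -?cTa // => /addIr.
move=> /eqP; rewrite -subr_eq0 -mulrBl mulf_eq0 subr_eq0 (inj_eq v_inj).
rewrite (negPf ba) => /eqP ->.
by rewrite (cardsD1 a) aT (cardsD1 b) bTa.
Qed.

(** For nonempty [T], [divpow k T] is the complete homogeneous symmetric polynomial of degree
    [k - #|T| + 1] in the nodes, a sum of ['C(k, #|T|.-1)] monomials. The induction along [divpowS]
    is Pascal's rule, and [1 <= B] allows raising the exponent to [k]. *)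
Lemma norm_divpow_le (B : C) k T : 1 <= B -> (forall i, i \in T -> `|v i| <= B) ->
  `|divpow k T| <= 'C(k, #|T|.-1)%:R * B ^+ k.
Proof.
move=> B1; have B0 : 0 <= B by rewrite (le_trans ler01).
elim: k T => [|k IHk] T vT.
  rewrite divpow0 mulr1; case: #|T| => [|[|m]] /=; rewrite ?normr0 ?normr1 //.
have [T0|[a aT]] := set_0Vmem T.
  by rewrite T0 /divpow big_set0 normr0 mulr_ge0 ?exprn_ge0.
rewrite (divpowS k aT) (le_trans (ler_normD _ _)) // normrM.
have cT : #|T|.-1 = #|T :\ a| by rewrite (cardsD1 a) aT.
have le1 : `|v a| * `|divpow k T| <= 'C(k, #|T|.-1)%:R * B ^+ k.+1.
  by rewrite exprS mulrCA ler_pM ?normr_ge0 ?vT ?IHk.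
have [Ta0|[b bTa]] := set_0Vmem (T :\ a).
  move: le1; rewrite cT Ta0 cards0 !bin0 => le1.
  by rewrite /divpow big_set0 normr0 addr0.
have [c cE] : {c | #|T :\ a| = c.+1} by rewrite (cardsD1 b) bTa; eexists.
rewrite cT cE binS natrD mulrDl lerD //; first by rewrite -cE -cT.
apply: le_trans (IHk _ _) _ => [i|]; first by rewrite !inE => /andP[_ /vT].
by rewrite cE ler_wpM2l // exprS ler_peMl ?exprn_ge0.
Qed.
End DividedPower.

(** * Sums of squared binomial coefficients *)

Lemma sum_bin_sqr_le (r s : nat) :
  (3 ^ s * \sum_(k < r) 'C(k, s) ^ 2 <= r ^ (2 * s).+1)%N.
Proof.
elim: s => [|s IHs].
  rewrite mul1n; under eq_bigr do rewrite bin0.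
  by rewrite sum_nat_const card_ord muln1.
(* The step from s = 0 to s = 1 needs the constant 3; later ones allow 4. *)
case: s IHs => [_|s IHs].
  elim: r => [|r IHr]; first by rewrite big_ord0.
  rewrite big_ord_recr /= bin1 mulnDr (leq_trans (leq_add IHr (leqnn _))) //.
  by rewrite !expnS !expn0; nia.
(* Termwise, [s.+2 * a = (k - s.+1) * b] gives [2 * a <= r * b], so even [4 * a ^ 2] is at most
   [r ^ 2 * b ^ 2]. *)
have step :
    (3 * \sum_(k < r) 'C(k, s.+2) ^ 2 <= r ^ 2 * \sum_(k < r) 'C(k, s.+1) ^ 2)%N.
  rewrite !big_distrr /=; apply: leq_sum => k _.
  have := mul_bin_left k s.+1; set a := 'C(k, s.+2); set b := 'C(k, s.+1) => ab.
  have le2a : (2 * a <= r * b)%N.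
    rewrite (leq_trans (_ : _ <= s.+2 * a)%N) ?leq_mul2r ?orbT // ab leq_mul2r.
    by rewrite (leq_trans (leq_subr _ _)) ?orbT // ltnW.
  rewrite -expnMn (leq_trans (_ : _ <= (2 * a) ^ 2)%N) ?leq_exp2r //.
  by rewrite expnMn leq_mul2r orbT.
have -> : (2 * s.+2).+1 = (2 + (2 * s.+1).+1)%N by lia.
rewrite expnS -mulnA mulnCA expnD (leq_trans _ (leq_mul (leqnn _) IHs)) //.
by rewrite (mulnCA (r ^ 2)%N) leq_mul2l step orbT.
Qed.

Lemma sum_bin_sqr_ler (C : numClosedFieldType) (r s : nat) :
  \sum_(k < r) 'C(k, s)%:R ^+ 2 <= (r%:R ^+ 2 / 3) ^+ s * r%:R :> C.
Proof.
rewrite expr_div_n -mulrA [_^-1 * _]mulrC mulrA ler_pdivlMr ?exprn_gt0 //.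
rewrite -exprM -exprSr mulrC.
under eq_bigr do rewrite -natrX.
by rewrite -natr_sum -!natrX -natrM ler_nat sum_bin_sqr_le.
Qed.

Lemma le_max1_norm (C : numClosedFieldType) (x y : C) :
  (y <= Num.max 1 `|x|) = (y <= 1) || (y <= `|x|).
Proof. by rewrite comparable_le_max // real_comparable ?real1 ?normr_real. Qed.

(** * The Vandermonde determinant with divided differences along edges *)

Section DividedVandermonde.
Variables (C : numClosedFieldType) (r : nat) (v : 'I_r -> C) (E : {set 'I_r * 'I_r}).
Hypotheses (v_inj : injective v)
  (v_homo : {homo v : i j / (i <= j)%N >-> `|i| <= `|j|})
  (E_lt : forall p, p \in E -> (p.1 < p.2)%N).

Let S j := [set i | (i, j) \in E].

(* The j-th row has the divided differences at j and its earlier neighbours. *)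
Let divmx : 'M[C]_r := \matrix_(j, k) divpow v k (j |: S j).

Let S_irr j : j \notin S j.
Proof. by rewrite inE; apply/negP => /E_lt; rewrite /= ltnn. Qed.

Lemma big_edges (R : Type) (idx : R) (op : Monoid.com_law idx) (F : 'I_r -> 'I_r -> R) :
  \big[op/idx]_(p in E) F p.1 p.2 = \big[op/idx]_j \big[op/idx]_(i in S j) F i j.
Proof.
rewrite (exchange_big_dep predT) //= pair_big_dep /=.
by apply: eq_bigl => -[i j]; rewrite /= inE.
Qed.

Lemma det_divmx :
  \det divmx * \prod_(p in E) (v p.2 - v p.1) =
  \prod_(i < r) \prod_(j < r | (i < j)%N) (v j - v i).
Proof.
(* The coefficients of the divided differences in terms of the powers. [U] is lower triangular
   because row [j] only involves [j] and earlier neighbours; its diagonal entries are the inverses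
   of the products of [v j - v l] over [l] in [S j]. *)
pose U : 'M[C]_r := \matrix_(j, i)
  ((i \in j |: S j)%:R / \prod_(l in (j |: S j) :\ i) (v i - v l)).
have -> : divmx = U *m (Vandermonde r (\row_i v i))^T.
  apply/matrixP => j k; rewrite !mxE /divpow big_mkcond /=; apply: eq_bigr => i _.
  by rewrite !mxE; case: ifP; rewrite ?mul0r // mul1r mulrC.
have Utrig : is_trig_mx U.
  apply/is_trig_mxP => j i ltji; rewrite mxE !inE.
  case: eqP => [ij|_] /=; first by rewrite ij ltnn in ltji.
  by case: (boolP (_ \in E)) => [/E_lt /=|]; rewrite ?mul0r // ltnNge ltnW.
rewrite det_mulmx det_tr det_Vandermonde (det_trig Utrig).
rewrite (big_edges _ (fun i j => v j - v i)) mulrAC -big_split /= big1 ?mul1r.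
  by apply: eq_bigr => i _; apply: eq_bigr => j _; rewrite !mxE.
move=> j _; rewrite mxE setU11 setU1K ?S_irr // mul1r mulVf //.
apply/prodf_neq0 => i iS; rewrite subr_eq0 (inj_eq v_inj).
by apply: contraTneq iS => <-; rewrite S_irr.
Qed.

Let B j : C := Num.max 1 `|v j|.

Lemma norm_det_divmx_le :
  `|\det divmx| ^+ 2 <=
  (r%:R ^+ 2 / 3) ^+ #|E| * r%:R ^+ r * \prod_j B j ^+ (2 * (r - 1)).
Proof.
have B1 j : 1 <= B j by rewrite le_max1_norm lexx.
apply: le_trans (hadamard _) _.
have -> : (r%:R ^+ 2 / 3) ^+ #|E| * r%:R ^+ r =
    \prod_(j < r) ((r%:R ^+ 2 / 3) ^+ #|S j| * r%:R) :> C.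
  rewrite big_split /= prodr_const card_ord; congr (_ * _).
  rewrite prodrXr -sum1_card (big_edges _ (fun _ _ => 1%N)); congr (_ ^+ _).
  by apply: eq_bigr => j _; rewrite sum1_card.
rewrite -big_split /=; apply: ler_prod => j _.
rewrite sumr_ge0 ?(fun j => exprn_ge0) //= => [|k _]; last by rewrite exprn_ge0.
apply: le_trans (_ : \sum_(k < r) 'C(k, #|S j|)%:R ^+ 2 * B j ^+ (2 * (r - 1)) <= _).
  apply: ler_sum => k _; rewrite mxE mulnC exprM -exprMn lerXn2r ?nnegrE //.
    by rewrite mulr_ge0 ?exprn_ge0 // (le_trans ler01).
  (* The ordering by modulus enters here: every node of row [j] is bounded by the bound for [v j]
     alone. *)
  have vB i : i \in j |: S j -> `|v i| <= B j.
    rewrite !inE le_max1_norm => ij.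
    rewrite v_homo ?orbT //.
    by case/orP: ij => [/eqP-> //|/E_lt/ltnW].
  apply: le_trans (norm_divpow_le v_inj k (B1 j) vB) _.
  rewrite cardsU1 S_irr /= ler_wpM2l // ler_weXn2l //.
  by rewrite -ltnS subn1 prednK // (leq_ltn_trans _ (ltn_ord k)).
rewrite -mulr_suml ler_wpM2r ?sum_bin_sqr_ler // exprn_ge0 //.
by rewrite (le_trans ler01).
Qed.

Lemma vandermonde_sqr_le :
  \prod_(p : 'I_r * 'I_r | (p.1 < p.2)%N) `|v p.1 - v p.2| ^+ 2 <=
  \prod_(p in E) `|v p.1 - v p.2| ^+ 2 *
  ((r%:R ^+ 2 / 3) ^+ #|E| * r%:R ^+ r * \prod_j B j ^+ (2 * (r - 1))).
Proof.
have -> : \prod_(p : 'I_r * 'I_r | (p.1 < p.2)%N) `|v p.1 - v p.2| ^+ 2 =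
    `|\det divmx| ^+ 2 * \prod_(p in E) `|v p.1 - v p.2| ^+ 2.
  under [\prod_(p in E) _]eq_bigr do rewrite distrC.
  rewrite !prodrXl -!normr_prod -exprMn -normrM det_divmx pair_big_dep /=.
  by rewrite !normr_prod; congr (_ ^+ 2); apply: eq_bigr => p _; rewrite distrC.
rewrite mulrC ler_wpM2l ?norm_det_divmx_le // prodr_ge0 // => p _.
by rewrite exprn_ge0.
Qed.
End DividedVandermonde.

(** * Products over unordered pairs under a change of order *)

Lemma big_sym_pairs (R : Type) (idx : R) (op : Monoid.com_law idx) (I : finType)
    (lt1 lt2 e : rel I) (F : I -> I -> R) :
  (forall i j, i != j -> lt1 j i = ~~ lt1 i j) ->
  (forall i j, i != j -> lt2 j i = ~~ lt2 i j) ->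
  symmetric e -> irreflexive e -> (forall i j, F i j = F j i) ->
  \big[op/idx]_(p | lt1 p.1 p.2 && e p.1 p.2) F p.1 p.2 =
  \big[op/idx]_(p | lt2 p.1 p.2 && e p.1 p.2) F p.1 p.2.
Proof.
move=> t1 t2 esym eirr Fsym.
have neq i j : e i j -> i != j by apply: contraTneq => ->; rewrite eirr.
rewrite (bigID (fun p => lt2 p.1 p.2)) /= [RHS](bigID (fun p => lt1 p.1 p.2)) /=.
congr (op _ _); first by apply: eq_bigl => p; do !case: (_ p.1 p.2).
(* The pairs that the two relations orient alike are already matched; the swap matches the remaining
   ones. *)
pose swap (p : I * I) := (p.2, p.1).
have swapK : involutive swap by case.
rewrite (reindex_inj (inv_inj swapK)) /=.
apply: eq_big => [[i j]|[i j] _] //=; rewrite esym.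
by case: (boolP (e i j)) => [/neq ij|]; rewrite ?andbF //= (t1 _ _ ij) (t2 _ _ ij) negbK !andbT andbC.
Qed.

Lemma ltn_ord_total (n : nat) (i j : 'I_n) : i != j -> (j < i)%N = ~~ (i < j)%N.
Proof. by rewrite -val_eqE; case: ltngtP. Qed.

(** The map [g] need not be monotone, so each pair is reoriented by the order of its images. This
    serves both the edges of the graph and the index sets of the subdiscriminant. *)
Lemma big_pairs_imset (R : Type) (idx : R) (op : Monoid.com_law idx) (n m : nat)
    (g : 'I_n -> 'I_m) (e : rel 'I_n) (F : 'I_m -> 'I_m -> R) :
  injective g -> symmetric e -> irreflexive e -> (forall i j, F i j = F j i) ->
  \big[op/idx]_(p in [set (g p.1, g p.2) | p in
      [set p : 'I_n * 'I_n | (g p.1 < g p.2)%N && e p.1 p.2]]) F p.1 p.2 =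
  \big[op/idx]_(p : 'I_n * 'I_n | (p.1 < p.2)%N && e p.1 p.2) F (g p.1) (g p.2).
Proof.
move=> g_inj esym eirr Fsym; rewrite big_imset /=; last first.
  by move=> [i j] [k l] _ _ /= [/g_inj-> /g_inj->].
rewrite -(@big_sym_pairs _ _ op _ (fun i j => g i < g j)%N (fun i j => i < j)%N e
  (fun i j => F (g i) (g j))) //; first by apply: eq_bigl => p; rewrite inE.
  by move=> i j; rewrite -(inj_eq g_inj); apply: ltn_ord_total.
by move=> i j; apply: ltn_ord_total.
Qed.

(** * Upper bound for the subdiscriminant *)

Section Subdiscriminant.
Variables (C : numClosedFieldType) (xs s : seq C).
Hypotheses (s_uniq : uniq s) (s_xs : s =i xs).

Let r := size s.

Let D2 : C := \prod_(p : 'I_r * 'I_r | (p.1 < p.2)%N) `|s`_p.1 - s`_p.2| ^+ 2.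

(** A member of [family fibres] chooses, for each distinct root, one of its occurrences in [xs]. *)
Let fibres (j : 'I_r) := [pred i : 'I_(size xs) | xs`_i == s`_j].

Lemma card_fibres : #|family fibres| = \prod_(x <- s) count_mem x xs.
Proof.
rewrite card_family foldrE big_map big_enum /= (big_nth 0) big_mkord.
apply: eq_bigr => j _; rewrite -sum1_card -sum1_count (big_nth 0) big_mkord.
by apply: eq_bigl => i; rewrite inE.
Qed.

Lemma inj_fibres (c : 'I_r -> 'I_(size xs)) :
  (forall j, c j \in fibres j) -> injective c.
Proof.
move=> cP i j cij; apply/val_inj/eqP; rewrite -(nth_uniq 0 (ltn_ord i) (ltn_ord j) s_uniq).
by have := cP i; have := cP j; rewrite -cij !inE => /eqP <- /eqP <-.
Qed.

Lemma norm_sDisc_summand (c : {ffun 'I_r -> 'I_(size xs)}) : c \in family fibres ->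
  `|\prod_(i in c @: setT) \prod_(j in c @: setT | (i < j)%N) (xs`_i - xs`_j) ^+ 2| = D2.
Proof.
move=> /familyP cP; have c_inj := inj_fibres cP.
have xc j : xs`_(c j) = s`_j by have := cP j; rewrite inE => /eqP.
rewrite pair_big_dep normr_prod.
pose F (i j : 'I_(size xs)) : C := `|xs`_i - xs`_j| ^+ 2.
rewrite (eq_bigr (fun p => F p.1 p.2)); last by move=> p _; rewrite normrX.
(* The relation [p.1 != p.2] is the complete graph on the distinct roots. *)
rewrite (eq_bigl (mem [set (c p.1, c p.2) | p in
  [set p : 'I_r * 'I_r | (c p.1 < c p.2)%N && (p.1 != p.2)]])) => [|[a b] /=].
  rewrite (@big_pairs_imset _ _ _ _ _ c (fun i j => i != j) F) //.
  - apply: eq_big => [p|p _]; last by rewrite /F !xc.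
    by case: ltngtP => //= lt12; rewrite -(inj_eq val_inj) neq_ltn lt12.
  - by move=> i j; rewrite eq_sym.
  - by move=> i; rewrite eqxx.
  - by move=> i j; rewrite /F distrC.
apply/and3P/imsetP => /= [[/imsetP[i _ ->] /imsetP[j _ ->] ltij]|].
  exists (i, j) => //; rewrite inE /= ltij; apply/eqP => ij.
  by rewrite ij ltnn in ltij.
by move=> [[i j]]; rewrite inE /= => /andP[ltij _] [-> ->]; rewrite !imset_f.
Qed.

(** A repeated root among the chosen indices would give a zero factor, so the [r] indices of [I]
    carry [r] different roots, hence all of them. *)
Lemma sDisc_summand_supp (I : {set 'I_(size xs)}) : #|I| = r ->
  \prod_(i in I) \prod_(j in I | (i < j)%N) (xs`_i - xs`_j) ^+ 2 != 0 ->
  exists2 c, c \in family fibres & I = c @: setT.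
Proof.
move=> cI /prodf_neq0 nz.
have sI (i : 'I_(size xs)) : (index (nth 0%R xs i) s < r)%N by rewrite index_mem s_xs mem_nth.
pose K i := Ordinal (sI i).
have KE (i : 'I_(size xs)) : s`_(K i) = xs`_i by rewrite nth_index // s_xs mem_nth.
have ltF i j : i \in I -> j \in I -> (i < j)%N -> K i <> K j.
  move=> iI jI ltij Kij; have /prodf_neq0/(_ j) := nz i iI.
  by rewrite jI ltij -!KE Kij subrr expr0n eqxx => /(_ isT).
have K_inj : {in I &, injective K}.
  move=> i j iI jI Kij; apply: val_inj; case: (ltngtP i j) => // lt.
    by case: (ltF _ _ iI jI lt).
  by case: (ltF _ _ jI iI lt).
have KI : K @: I = setT.
  by apply/eqP; rewrite eqEcard subsetT cardsT card_ord card_in_imset // cI leqnn.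
have /fin_all_exists[c cP] (j : 'I_r) : exists i, (i \in I) && (i \in fibres j).
  have : j \in K @: I by rewrite KI.
  by move=> /imsetP[i iI ->]; exists i; rewrite iI inE KE eqxx.
have cfib j : finfun c j \in fibres j by rewrite ffunE; case/andP: (cP j).
exists (finfun c); first exact/familyP.
apply/esym/eqP; rewrite eqEcard card_imset; last exact: (inj_fibres cfib).
rewrite cardsT card_ord cI leqnn andbT; apply/subsetP => _ /imsetP[j _ ->].
by rewrite ffunE; case/andP: (cP j).
Qed.

Lemma norm_sDisc_le (a : C) :
  `|sDisc a xs (size xs - r)| <=
  `|a| ^+ (2 * (r - 1)) * ((\prod_(x <- s) count_mem x xs)%:R * D2).
Proof.
have ler : (r <= size xs)%N by apply: uniq_leq_size => // x; rewrite s_xs.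
rewrite /sDisc subKn // mulnBr muln1 normrM normrX ler_wpM2l ?exprn_ge0 //.
rewrite (le_trans (ler_norm_sum _ _ _)) //.
pose G (I : {set 'I_(size xs)}) : C :=
  `|\prod_(i in I) \prod_(j in I | (i < j)%N) (xs`_i - xs`_j) ^+ 2|.
have D2_ge0 : 0 <= D2 by apply: prodr_ge0 => p _; rewrite exprn_ge0.
pose A := [set (c : {ffun _ -> _}) @: setT | c in family fibres].
(* Only images of choice functions contribute, each at most [D2], and there are no more images than
   choices. *)
apply: le_trans (_ : \sum_(I in A) D2 <= _); last first.
  by rewrite sumr_const -card_fibres mulr_natl ler_wpMn2l // leq_imset_card.
rewrite [leLHS]big_mkcond [leRHS]big_mkcond /=; apply: ler_sum => I _.
case: (boolP (I \in A)) => [/imsetP[c cfam ->]|nIA].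
  by rewrite norm_sDisc_summand //; case: ifP.
case: ifP => // /eqP cI; rewrite normr_le0; apply: contraNT nIA.
by move=> /(sDisc_summand_supp cI)[c cfam ->]; apply: imset_f.
Qed.
End Subdiscriminant.

(** * The product of the multiplicities *)

Lemma prod_count_le (T : eqType) (s : seq T) :
  let m := (\prod_(x <- undup s) count_mem x s)%N in
  (m ^ 3 <= 3 ^ minn (size s) (2 * size s - 2 * size (undup s)))%N.
Proof.
have sumE : (\sum_(x <- undup s) count_mem x s = size s)%N.
  rewrite -(sum1_size s) -[RHS](big_undup_iterop_count addn s predT (fun _ => 1%N)).
  by apply: eq_bigr => x _; rewrite Monoid.iteropE iter_addn_0 mul1n.
have sumE' : (\sum_(x <- undup s) 2 * (count_mem x s - 1) = 2 * size s - 2 * size (undup s))%N.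
  rewrite -big_distrr /= -mulnBr -sumE -(sum1_size (undup s)); congr (2 * _)%N.
  rewrite [LHS]big_seq [X in (X - _)%N]big_seq [X in (_ - X)%N]big_seq sumnB // => x.
  by rewrite mem_undup -has_pred1 has_count.
(* Equality holds at [k = 3]; beyond it, [k.+1 ^ 3 <= 3 * k ^ 3] drives the induction. *)
have cube k : (k ^ 3 <= 3 ^ k)%N.
  case: k => [|[|[|]]] //; elim=> [|k IHk] //.
  rewrite [leqRHS]expnS (leq_trans _ (leq_mul (leqnn 3) IHk)) // !expnS expn0; nia.
(* Direct for 1 and 2 ([8 <= 9]); from 3 on, [k <= 2 * (k - 1)] reduces it to [cube]. *)
have cube' k : (0 < k)%N -> (k ^ 3 <= 3 ^ (2 * (k - 1)))%N.
  case: k => [|[|[|k]]] // _; apply: leq_trans (cube _) _.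
  by rewrite leq_exp2l //; lia.
rewrite /minn; case: ifP => _; [rewrite -sumE|rewrite -sumE'].
all: rewrite expn_sum (big_morph (expn^~ 3)%N (fun a b => expnMn a b 3) (exp1n 3)).
  exact: leq_prod.
rewrite big_seq [leqRHS]big_seq; apply: leq_prod => x xs.
by rewrite cube' // -has_count has_pred1 -mem_undup.
Qed.

Lemma prod_undup_ler (R : numDomainType) (T : eqType) (F : T -> R) (s : seq T) :
  (forall x, 1 <= F x) -> \prod_(x <- undup s) F x <= \prod_(x <- s) F x.
Proof.
move=> F1; have F0 x : 0 <= F x by rewrite (le_trans ler01).
elim: s => [|x s IHs] //=; rewrite big_cons.
case: ifP => _; last by rewrite big_cons ler_wpM2l.
by rewrite (le_trans IHs) // ler_peMl // prodr_ge0.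
Qed.

(** Cubing turns the squared power of the sixth root into a power of [3^-1], leaving an inequality
    between natural numbers. *)
Lemma count_rootC_le1 (C : numClosedFieldType) (T : eqType) (s : seq T) :
  (\prod_(x <- undup s) count_mem x s)%:R *
  (6.-root 3^-1 ^+ minn (size s) (2 * size s - 2 * size (undup s))) ^+ 2 <= 1 :> C.
Proof.
have root_ge0 : 0 <= 6.-root (3^-1) :> C by rewrite rootC_ge0 ?invr_ge0.
rewrite -(@expr_le1 _ 3) // ?mulr_ge0 ?exprn_ge0 // exprMn -natrX.
rewrite -!exprM -mulnA mulnC exprM rootCK // exprVn ler_pdivrMr ?exprn_gt0 //.
by rewrite mul1r -natrX ler_nat; apply: prod_count_le.
Qed.

(** * Assembly of the lower bound *)

Theorem theorem3 (C : numClosedFieldType) (P : {poly C}) (xs : seq C)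
  (hdeg : (1 < size P)%N)
  (hP : P = lead_coef P *: \prod_(x <- xs) ('X - x%:P))
  (n : nat) (f : 'I_n -> C) (e : rel 'I_n)
  (hf_inj : injective f) (hf_root : forall i, f i \in xs)
  (he_sym : symmetric e) (he_irr : irreflexive e) :
  let d := size xs in
  let r := size (undup xs) in
  let nE := #|[set p : 'I_n * 'I_n | (p.1 < p.2)%N && e p.1 p.2]| in
  \prod_(p : 'I_n * 'I_n | (p.1 < p.2)%N && e p.1 p.2) `|f p.1 - f p.2|
  >= sqrtC `|sDisc (lead_coef P) xs (d - r)|
     * (mahler (lead_coef P) xs) ^- (r - 1)
     * (r%:R / sqrtC 3) ^- nE
     * (sqrtC r%:R) ^- r
     * (6.-root (3^-1)) ^+ minn d (2 * d - 2 * r).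
Proof.
set a := lead_coef P in hP *.
have a_neq0 : a != 0.
  by rewrite lead_coef_eq0; apply: contraTneq hdeg => ->; rewrite size_poly0.
have xs_gt0 : (0 < size xs)%N.
  by move: hdeg; rewrite hP size_scale // size_prod_XsubC.
pose le_norm (x y : C) := `|x| <= `|y|.
set s := sort le_norm (undup xs).
have s_uniq : uniq s by rewrite sort_uniq undup_uniq.
have s_xs : s =i xs by move=> x; rewrite mem_sort mem_undup.
have s_perm : perm_eq s (undup xs) by rewrite perm_sort.
have s_sorted : sorted le_norm s.
  by apply: sort_sorted => x y; rewrite /le_norm real_leVge ?normr_real.
have rE : size (undup xs) = size s by rewrite size_sort.
cbv zeta; rewrite rE; set d := size xs; set r := size s.
set nE := #|_|.
have r_gt0 : (0 < r)%N.
  by have := mem_nth 0 xs_gt0; rewrite -s_xs /r; case: (s).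
pose v (i : 'I_r) := s`_i.
have v_inj : injective v.
  move=> i j vij; apply/val_inj/eqP.
  by rewrite -(nth_uniq 0 (ltn_ord i) (ltn_ord j) s_uniq) -/(v i) vij.
have v_homo : {homo v : i j / (i <= j)%N >-> `|i| <= `|j|}.
  move=> i j leij; apply: (sorted_leq_nth _ _ 0 s_sorted); rewrite ?inE //.
  - by move=> y x z; apply: le_trans.
  - by move=> x; apply: lexx.
have f_s i : f i \in s by rewrite s_xs.
have g_lt i : (index (f i) s < r)%N by rewrite index_mem.
pose g i : 'I_r := Ordinal (g_lt i).
have vg i : v (g i) = f i by rewrite /v nth_index.
have g_inj : injective g by move=> i j gij; apply: hf_inj; rewrite -!vg gij.
(* The edges of the graph, moved to positions in the sorted list [s] and oriented towards the larger
   position. *)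
pose E := [set (g p.1, g p.2) | p in [set p : 'I_n * 'I_n | (g p.1 < g p.2)%N && e p.1 p.2]].
have E_lt p : p \in E -> (p.1 < p.2)%N.
  by move=> /imsetP[q]; rewrite inE => /andP[lt_q _] ->.
have cardE : #|E| = nE.
  rewrite -sum1_card (big_pairs_imset _ (F := fun _ _ => 1%N)) //.
  by rewrite /nE -sum1_card; apply: eq_bigl => p; rewrite inE.
set PE := \prod_(p | _) _.
have prodE : \prod_(p in E) `|v p.1 - v p.2| ^+ 2 = PE ^+ 2.
  rewrite prodrXl (big_pairs_imset _ (F := fun i j => `|v i - v j|)) //.
    by congr (_ ^+ 2); apply: eq_bigr => p _; rewrite !vg.
  by move=> i j; rewrite distrC.
have := vandermonde_sqr_le v_inj v_homo E_lt; rewrite cardE prodE.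
have := norm_sDisc_le s_uniq s_xs a.
have := @count_rootC_le1 C _ xs.
rewrite rE -(perm_big _ s_perm) /= -/r -/d !prodrXl.
set m := (\prod_(x <- s) _)%N; set D := \prod_(p | _) _.
set rho := _ ^+ minn _ _; set Q := \prod_(j < r) _; set M := mahler a xs.
move=> rho_le sDisc_le D_le.
have Q_ge0 : 0 <= Q.
  by apply: prodr_ge0 => j _; rewrite (le_trans ler01) // le_max1_norm lexx.
(* [Q] runs over distinct roots only; repeating roots can only increase the product, as each factor
   is at least 1. *)
have aQ_le : `|a| * Q <= M.
  rewrite ler_wpM2l // /Q -(big_mkord xpredT (fun i => Num.max 1 `|s`_i|)).
  rewrite -(big_nth 0 xpredT (fun x => Num.max 1 `|x|)) (perm_big _ s_perm).
  by apply: prod_undup_ler => x; rewrite le_max1_norm lexx.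
have M_gt0 : 0 < M.
  rewrite mulr_gt0 ?normr_gt0 // prodr_gt0 // => x _.
  by rewrite (lt_le_trans ltr01) // le_max1_norm lexx.
have sqrt3_gt0 : 0 < sqrtC 3 :> C by rewrite sqrtC_gt0.
have rR_gt0 : 0 < r%:R :> C by rewrite ltr0n.
have sqrtr_gt0 : 0 < sqrtC r%:R :> C by rewrite sqrtC_gt0.
have rho_ge0 : 0 <= rho by rewrite exprn_ge0 // rootC_ge0 ?invr_ge0.
have PE_ge0 : 0 <= PE by apply: prodr_ge0.
have -> : forall x y z w t : C, x / y / z / w * t = x * t / (y * z * w).
  by move=> *; rewrite !invfM; ring.
have den_gt0 : 0 < M ^+ (r - 1) * (r%:R / sqrtC 3) ^+ nE * sqrtC r%:R ^+ r.
  by rewrite !mulr_gt0 ?exprn_gt0 ?divr_gt0.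
(* With all negative powers in one denominator, both sides are squared to remove the square
   roots. *)
rewrite ler_pdivrMr // -(@ler_pXn2r _ 2) ?nnegrE ?(mulr_ge0 PE_ge0 (ltW den_gt0)) //; last first.
  by rewrite mulr_ge0 ?sqrtC_ge0.
have -> : forall x y z w : C, (x * (y * z * w)) ^+ 2 = x ^+ 2 * (y ^+ 2 * z ^+ 2 * w ^+ 2).
  by move=> *; ring.
rewrite exprMn sqrtCK (_ : _ ^+ nE ^+ 2 = (r%:R ^+ 2 / 3) ^+ nE); last first.
  by rewrite exprAC expr_div_n sqrtCK.
rewrite (_ : _ ^+ r ^+ 2 = r%:R ^+ r); last by rewrite exprAC sqrtCK.
rewrite -(exprM M) [((r - 1) * 2)%N]mulnC.
set R := (_ / _) ^+ nE in D_le *; set k := (2 * _)%N in sDisc_le D_le *.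
have R_ge0 : 0 <= R by rewrite exprn_ge0 // divr_ge0 ?exprn_ge0.
apply: le_trans (ler_wpM2r (exprn_ge0 2 rho_ge0) sDisc_le) _.
(* [rho ^+ 2] is grouped with the multiplicities [m], which it absorbs by [rho_le]. *)
have -> : `|a| ^+ k * (m%:R * D ^+ 2) * rho ^+ 2 =
    (m%:R * rho ^+ 2) * (`|a| ^+ k * D ^+ 2) by ring.
have D2_ge0 : 0 <= D ^+ 2 by rewrite exprn_ge0 //; apply: prodr_ge0.
apply: le_trans (ler_piMl _ rho_le) _; first by rewrite mulr_ge0 // exprn_ge0.
apply: le_trans (ler_wpM2l (exprn_ge0 k (normr_ge0 a)) D_le) _.
(* The leading coefficient and the row bounds carry the same exponent [k = 2 * (r - 1)], so they
   combine into a power of [|a| * Q], bounded by [M]. *)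
have -> : `|a| ^+ k * (PE ^+ 2 * (R * r%:R ^+ r * Q ^+ k)) =
    PE ^+ 2 * (R * r%:R ^+ r) * (`|a| * Q) ^+ k by rewrite exprMn; ring.
have -> : PE ^+ 2 * (M ^+ k * R * r%:R ^+ r) =
    PE ^+ 2 * (R * r%:R ^+ r) * M ^+ k by ring.
apply: ler_wpM2l; first by rewrite !mulr_ge0 // exprn_ge0.
by rewrite lerXn2r ?nnegrE ?(ltW M_gt0) // mulr_ge0.
Qed.
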